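(* For every integer $n\geq 1$ the following identities hold in $\mathbb{Q}[t]$: \begin{align*} \binom{2n}{n}\sum_{k=1}^n \frac{t^{k-1}}{k\binom{2k}{k}} &= \sum_{k=1}^{n} \binom{2n}{n-k}\frac{u_{k}(t-2)}{k},\\ \binom{2n}{n}\sum_{k=1}^n \frac{t^k}{k^2\binom{2k}{k}} &= \sum_{k=1}^{n} \binom{2n}{n-k}\frac{v_{k}(t-2)}{k^2}+\binom{2n}{n}\sum_{k=1}^n \frac{1}{k^2},\\ \binom{2n}{n}\sum_{k=1}^n \frac{t^k}{k^3\binom{2k}{k}} &= \sum_{k=1}^{n} \binom{2n}{n-k}\frac{v_{k}(t-2)}{k^3} +2\sum_{1\leq j<k\leq n}\binom{2n}{n-k}\frac{(-1)^{k-j}\,v_{j}(t-2)}{jk^2} +\binom{2n}{n}\sum_{k=1}^n \frac{1}{k^3}. \end{align*}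
   Context: The Lucas polynomials $u_n(x),v_n(x)\in\mathbb{Z}[x]$ are defined by $u_0=0$, $u_1=1$, $u_n(x)=x\,u_{n-1}(x)-u_{n-2}(x)$ for $n>1$, and $v_0=2$, $v_1=x$, $v_n(x)=x\,v_{n-1}(x)-v_{n-2}(x)$ for $n>1$. *)

(* Defs.v *)
From mathcomp Require Import all_boot all_order all_algebra.

Set Implicit Arguments.
Unset Strict Implicit.
Unset Printing Implicit Defensive.

Import GRing.Theory.
Local Open Scope ring_scope.

Fixpoint lucasU (n : nat) : {poly int} :=
  match n with
  | 0 => 0
  | m.+1 => match m with
            | 0 => 1
            | p.+1 => 'X * lucasU m - lucasU p
            end
  end.

Fixpoint lucasV (n : nat) : {poly int} :=
  match n with
  | 0 => 2%:P
  | m.+1 => match m with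
            | 0 => 'X
            | p.+1 => 'X * lucasV m - lucasV p
            end
  end.

(* The polynomial p(t - 2) in Q[t], for p with integer coefficients. *)
Definition at_t_sub2 (p : {poly int}) : {poly rat} :=
  map_poly (intr : int -> rat) p \Po ('X - 2%:P).

(* Main.v *)
(** Put [rbin n k = C(2n,n-k) / C(2n,n)].  After division by [C(2n,n)], each
    identity is proved by comparing increments in [n], because
    [rbin n k - rbin (n-1) k = (k / n)^2 rbin n k].  The increments follow from
    [t^n = C(2n,n) + \sum_(k >= 1) C(2n,n-k) v_k(t-2)], which is the binomial
    expansion of [(x+1)^(2n) / x^n] at [t - 2 = x + x^-1]; from its derivative
    for the first identity, as [v_k' = k u_k]; and from a telescoping sum for
    the third. *)
Require Import Defs.
From mathcomp Require Import all_boot all_order all_algebra.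
From mathcomp Require Import zify ring.

Import GRing.Theory Num.Theory.
Local Open Scope ring_scope.

(** * Lucas polynomials and their evaluation at [t - 2] *)

Lemma lucasU_rec n : lucasU n.+2 = 'X * lucasU n.+1 - lucasU n.
Proof. by []. Qed.

Lemma lucasV_rec n : lucasV n.+2 = 'X * lucasV n.+1 - lucasV n.
Proof. by []. Qed.

Lemma lucasV_lucasU n : lucasV n.+1 = lucasU n.+2 - lucasU n.
Proof.
suff [] : lucasV n.+1 = lucasU n.+2 - lucasU n /\
          lucasV n.+2 = lucasU n.+3 - lucasU n.+1 by [].
elim: n => [|n [IH0 IH1]].
  rewrite lucasV_rec !lucasU_rec /= (_ : 2%:P = 1 + 1) ?polyC_natr //.
  by split; ring.
by split=> //; rewrite lucasV_rec IH0 IH1 !lucasU_rec; ring.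
Qed.

(** Differentiating the recurrence leaves an extra [v_(n+1)]; writing it as [u_(n+2) - u_n] turns
    the right side into [(n+2) u_(n+2)]. *)
Lemma deriv_lucasV n : (lucasV n)^`() = lucasU n *+ n.
Proof.
suff [] : (lucasV n)^`() = lucasU n *+ n /\
          (lucasV n.+1)^`() = lucasU n.+1 *+ n.+1 by [].
elim: n => [|n [IH0 IH1]]; first by rewrite /= derivC derivX.
split=> //.
rewrite lucasV_rec derivB derivM derivX IH0 IH1 lucasV_lucasU !lucasU_rec.
rewrite !mulrSr; ring.
Qed.

Local Notation shiftU k := (at_t_sub2 (lucasU k)).
Local Notation shiftV k := (at_t_sub2 (lucasV k)).

Lemma shiftV0 : shiftV 0 = 2%:P.
Proof. by rewrite /at_t_sub2 /= map_polyC comp_polyC. Qed.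

Lemma shiftV1 : shiftV 1 = 'X - 2%:P.
Proof. by rewrite /at_t_sub2 /= map_polyX comp_polyX. Qed.

Local Arguments lucasU : simpl never.
Local Arguments lucasV : simpl never.

(** Since [t = (t - 2) + 2], multiplication by [t] acts with the weights 1, 2, 1, the same as in a
    double Pascal step. *)
Lemma mulX_shiftV k :
  'X * shiftV k.+1 = shiftV k.+2 + 2 *: shiftV k.+1 + shiftV k.
Proof.
rewrite /at_t_sub2 lucasV_rec rmorphB rmorphM /= map_polyX.
rewrite comp_polyB comp_polyM comp_polyX -mul_polyC; ring.
Qed.

Lemma deriv_shiftV k : (shiftV k)^`() = k%:R *: shiftU k.
Proof.
rewrite /at_t_sub2 deriv_comp deriv_map deriv_lucasV derivB derivX derivC.
by rewrite subr0 mulr1 scaler_nat [map_poly _ (_ *+ k)]rmorphMn /= [LHS]raddfMn.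
Qed.

(** * Central binomial coefficients and the expansion of [t^n] *)

Lemma pascal2 m k :
  'C(m.+2, k.+2) = ('C(m, k) + 2 * 'C(m, k.+1) + 'C(m, k.+2))%N.
Proof. rewrite !binS; lia. Qed.

(* [n + k] rather than [n - k]: it yields [0] for [k > n], whereas truncated
   subtraction would not. *)
Local Notation cbin n k := ('C(2 * n, n + k)%:R : rat).

Lemma central_recS n k :
  cbin n.+1 k.+1 = cbin n k + 2 * cbin n k.+1 + cbin n k.+2.
Proof.
rewrite (_ : 2 * n.+1 = (2 * n).+2)%N; last lia.
by rewrite addSn !addnS pascal2 2!natrD natrM.
Qed.

(** At the centre the two outer neighbours coincide by symmetry of the binomials, whence the second
    factor 2. *)
Lemma central_rec0 n : cbin n.+1 0 = 2 * cbin n 0 + 2 * cbin n 1.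
Proof.
have sym : 'C((2 * n).+1, n) = 'C((2 * n).+1, n.+1).
  by rewrite -bin_sub; [congr ('C(_, _)); lia | lia].
rewrite (_ : 2 * n.+1 = (2 * n).+2)%N; last lia.
rewrite addn0 binS sym binS addn0 addn1 !natrD; ring.
Qed.

Lemma central_out n k : (n < k)%N -> cbin n k = 0.
Proof. by move=> ltnk; rewrite bin_small //; lia. Qed.

(** Summation by parts: the 1, 2, 1 weights move from the polynomials to the binomials, and the four
    extra terms are the boundary at [M] and at 0. *)
Lemma sum_central_mulX n M :
  \sum_(1 <= k < M.+1) cbin n k *: ('X * shiftV k)
  = \sum_(1 <= k < M.+1) cbin n.+1 k *: shiftV k
    + cbin n M *: shiftV M.+1 - cbin n M.+1 *: shiftV M
    - cbin n 0 *: shiftV 1 + cbin n 1 *: shiftV 0.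
Proof.
elim: M => [|M IH]; first by rewrite !big_geq //; ring.
rewrite big_nat_recr //= [in RHS]big_nat_recr //= IH mulX_shiftV central_recS.
rewrite -!mul_polyC !rmorphD !rmorphM /=; ring.
Qed.

Lemma expX_central n :
  'X^n = (cbin n 0)%:P + \sum_(1 <= k < n.+1) cbin n k *: shiftV k.
Proof.
elim: n => [|n IH]; first by rewrite big_geq // expr0 addr0.
rewrite exprS IH mulrDr big_distrr /=.
under eq_bigr do rewrite -scalerAr.
(* The added term is zero, and with [M = n.+1] the upper boundary terms vanish too. *)
have -> : \sum_(1 <= k < n.+1) cbin n k *: ('X * shiftV k)
          = \sum_(1 <= k < n.+2) cbin n k *: ('X * shiftV k).
  by rewrite [RHS]big_nat_recr //= central_out // scale0r addr0.
rewrite sum_central_mulX (central_out n n.+1) // (central_out n n.+2) //.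
rewrite !scale0r shiftV0 shiftV1.
rewrite central_rec0 -!mul_polyC !rmorphD !rmorphM /=; ring.
Qed.

(** * Normalized binomials and their increments in [n] *)

Local Notation rbin n k := (cbin n k / cbin n 0).

Lemma central_neq0 n : cbin n 0 != 0.
Proof. by rewrite pnatr_eq0 -lt0n bin_gt0; lia. Qed.

Lemma natS_neq0 n : n.+1%:R != 0 :> rat.
Proof. by rewrite pnatr_eq0. Qed.

Lemma central_stepk n k : (k <= n)%N ->
  (n.+1%:R + k%:R) * cbin n k.+1 = (n%:R - k%:R) * cbin n k.
Proof.
move=> lekn; rewrite -natrD -natrB // -!natrM; congr _%:R.
by rewrite addnS addSn mul_bin_left; congr (_ * _)%N; lia.
Qed.

Lemma central_stepn n k : (k <= n.+1)%N ->
  (n.+1%:R ^+ 2 - k%:R ^+ 2) * cbin n.+1 k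
  = ((2 * n).+2 * (2 * n).+1)%:R * cbin n k.
Proof.
move=> lekn; rewrite subr_sqr -natrD -natrB // -!natrM; congr _%:R.
have e1 := mul_bin_diag (2 * n).+2 (n + k).
have e2 := mul_bin_down (2 * n).+1 (n + k).
rewrite /= in e1 e2.
rewrite (_ : 2 * n.+1 = (2 * n).+2)%N; last lia.
rewrite (addSn n k) -mulnA -e1 -mulnA e2 mulnCA.
by congr (_ * (_ * _))%N; lia.
Qed.

(** Dividing [central_stepn] at [k] by its case [k = 0] cancels the factor [(2n+2)(2n+1)], which
    does not depend on [k]. *)
Lemma ratio_stepn n k : (k <= n.+1)%N ->
  rbin n.+1 k = rbin n k + (n.+1%:R ^+ 2)^-1 * (rbin n.+1 k * k%:R ^+ 2).
Proof.
move=> lekn; have ek := central_stepn n k lekn.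
have e0 := central_stepn n 0 (leq0n n.+1).
have nz1 := central_neq0 n.+1; have nz2 := natS_neq0 n.
rewrite expr0n subr0 in e0.
set c := (_ * _)%N%:R in ek e0.
have nzc : c != 0 by rewrite pnatr_eq0.
clearbody c.
have -> : cbin n k = (n.+1%:R ^+ 2 - k%:R ^+ 2) * cbin n.+1 k / c.
  by rewrite ek mulrC mulKf.
have -> : cbin n 0 = (n.+1%:R ^+ 2) * cbin n.+1 0 / c.
  by rewrite e0 mulrC mulKf.
by field; rewrite nat1r nzc nz1 nz2.
Qed.

(** The increment carries a factor [k^2], so the power of [k] in a denominator drops by two and a
    sum of known value remains. *)
Lemma sum_ratio_stepn n (f : nat -> {poly rat}) :
  \sum_(1 <= k < n.+2) rbin n.+1 k *: f k
  = \sum_(1 <= k < n.+1) rbin n k *: f k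
    + (n.+1%:R ^+ 2)^-1 *:
        \sum_(1 <= k < n.+2) rbin n.+1 k *: (k%:R ^+ 2 *: f k).
Proof.
have -> : \sum_(1 <= k < n.+1) rbin n k *: f k
          = \sum_(1 <= k < n.+2) rbin n k *: f k.
  by rewrite [RHS]big_nat_recr //= (central_out n n.+1) // mul0r scale0r addr0.
rewrite scaler_sumr -big_split /=; apply: eq_big_nat => k /andP[_ lekn].
by rewrite !scalerA -scalerDl -mulrA -ratio_stepn.
Qed.

Lemma expX_ratio n :
  (cbin n 0)^-1 *: 'X^n = 1 + \sum_(1 <= k < n.+1) rbin n k *: shiftV k.
Proof.
rewrite expX_central scalerDr -mul_polyC -rmorphM mulVf ?central_neq0 //=.
congr (_ + _); rewrite scaler_sumr; apply: eq_bigr => k _.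
by rewrite scalerA mulrC.
Qed.

Lemma deriv_expX_ratio n :
  (n%:R / cbin n 0) *: 'X^(n.-1)
  = \sum_(1 <= k < n.+1) rbin n k *: (k%:R *: shiftU k).
Proof.
have := congr1 (@deriv rat) (expX_ratio n).
rewrite derivZ derivXn derivD derivC add0r raddf_sum /= -scaler_nat scalerA.
rewrite mulrC => ->; apply: eq_bigr => k _.
by rewrite derivZ deriv_shiftV.
Qed.

(** * Alternating inner sums of the third identity, and their telescoping *)

Definition altV k : {poly rat} :=
  \sum_(1 <= j < k) ((-1) ^+ (k - j) / j%:R) *: shiftV j.

Lemma altVS k : altV k.+2 = - altV k.+1 - k.+1%:R^-1 *: shiftV k.+1.
Proof.
rewrite /altV big_nat_recr //= subSnn expr1 mulN1r scaleNr; congr (_ - _).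
rewrite -sumrN; apply: eq_big_nat => j /andP[_ ltjk].
by rewrite (subSn (ltnW ltjk)) exprS mulN1r mulNr scaleNr.
Qed.

(** The remainder is explicit so that induction on [M] goes through; its factor [n.+1 - M] vanishes
    at the full range. *)
Lemma sum_ratio_altV_partial n M : (M <= n.+1)%N ->
  \sum_(1 <= k < M.+1) rbin n.+1 k *: (k%:R^-1 *: shiftV k + 2 *: altV k)
  = n.+1%:R^-1 *: (\sum_(1 <= k < M.+1) rbin n.+1 k *: shiftV k)
    - (rbin n.+1 M * (n.+1%:R - M%:R) / n.+1%:R) *: altV M.+1.
Proof.
elim: M => [_|M IH ltMn].
  by rewrite /altV !big_geq // !scaler0 subr0.
rewrite big_nat_recr //= IH 1?ltnW // [in RHS]big_nat_recr //= altVS.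
(* This makes the old remainder a multiple of the ratio at [M.+1], like all the new terms. *)
have -> : rbin n.+1 M * (n.+1%:R - M%:R) = (n.+2%:R + M%:R) * rbin n.+1 M.+1.
  by rewrite mulrAC [cbin _ M * _]mulrC -central_stepk 1?ltnW // mulrA.
set x := rbin _ _; set S := \sum_(_ <= _ < _) _.
rewrite !(scalerDr, scalerN, scalerA, scalerBr).
set c1 := (X in - (X *: altV _)).
(* The part [2 * x] cancels the [altV] summand; the rest becomes the new remainder through the sign
   change in [altVS]. *)
have -> : c1 = 2 * x - x * (n.+1%:R - M.+1%:R) / n.+1%:R.
  rewrite /c1 -(natr1 n.+1) -(natr1 M).
  by field; rewrite nat1r natS_neq0.
(* The first part extends the sum on the right; the second matches the last term of [altVS]. *)
have -> : x / M.+1%:R = n.+1%:R^-1 * x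
    + x * (n.+1%:R - M.+1%:R) / n.+1%:R / M.+1%:R.
  by field; rewrite !nat1r !natS_neq0.
clearbody x c1; move: (x * _ / _) => y.
rewrite -!mul_polyC !(rmorphD, rmorphN, rmorphM) /=; ring.
Qed.

Lemma sum_ratio_altV n :
  \sum_(1 <= k < n.+2) rbin n.+1 k *: (k%:R^-1 *: shiftV k + 2 *: altV k)
  = n.+1%:R^-1 *: \sum_(1 <= k < n.+2) rbin n.+1 k *: shiftV k.
Proof.
by rewrite sum_ratio_altV_partial // subrr mulr0 mul0r scale0r subr0.
Qed.

(** * The three identities, divided by the central binomial coefficient *)

Lemma centralE n : cbin n 0 = 'C(2 * n, n)%:R.
Proof. by rewrite addn0. Qed.

Lemma sum_shiftU n :
  \sum_(1 <= k < n.+1) (k%:R * cbin k 0)^-1 *: 'X^(k - 1)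
  = \sum_(1 <= k < n.+1) rbin n k *: (k%:R^-1 *: shiftU k).
Proof.
elim: n => [|n IH]; first by rewrite !big_geq.
rewrite sum_ratio_stepn big_nat_recr //= IH; congr (_ + _).
under [in RHS]eq_big_nat => k /andP[k_gt0 _].
  rewrite [_ ^+ 2 *: _]scalerA expr2 mulfK; last by rewrite pnatr_eq0 -lt0n.
  over.
rewrite -deriv_expX_ratio scalerA subn1; congr (_ *: _).
by field; rewrite nat1r natS_neq0 central_neq0.
Qed.

Lemma sum_shiftV2 n :
  \sum_(1 <= k < n.+1) (k%:R ^+ 2 * cbin k 0)^-1 *: 'X^k
  = \sum_(1 <= k < n.+1) rbin n k *: ((k%:R ^+ 2)^-1 *: shiftV k)
    + (\sum_(1 <= k < n.+1) (k%:R ^+ 2)^-1)%:P.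
Proof.
elim: n => [|n IH]; first by rewrite !big_geq // addr0.
rewrite sum_ratio_stepn big_nat_recr //= IH
  [\sum_(1 <= k < n.+2) (k%:R ^+ 2 : rat)^-1]big_nat_recr //=.
under [X in n.+1%:R ^- 2 *: X]eq_big_nat => k /andP[k_gt0 _].
  rewrite [_ ^+ 2 *: _]scalerA mulfV ?scale1r;
    last by rewrite expf_neq0 // pnatr_eq0 -lt0n.
  over.
(* The constant 1 in [expX_ratio] supplies the new summand of the sum of inverse squares. *)
rewrite invfM -scalerA expX_ratio scalerDr rmorphD /= alg_polyC; ring.
Qed.

Lemma sum_shiftV3 n :
  \sum_(1 <= k < n.+1) (k%:R ^+ 3 * cbin k 0)^-1 *: 'X^k
  = \sum_(1 <= k < n.+1)
      rbin n k *: ((k%:R ^+ 3)^-1 *: shiftV k + (2 / k%:R ^+ 2) *: altV k)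
    + (\sum_(1 <= k < n.+1) (k%:R ^+ 3)^-1)%:P.
Proof.
elim: n => [|n IH]; first by rewrite !big_geq // addr0.
rewrite sum_ratio_stepn big_nat_recr //= IH
  [\sum_(1 <= k < n.+2) (k%:R ^+ 3 : rat)^-1]big_nat_recr //=.
under [X in n.+1%:R ^- 2 *: X]eq_big_nat => k /andP[k_gt0 _].
  have nzk : k%:R != 0 :> rat by rewrite pnatr_eq0 -lt0n.
  rewrite [_ ^+ 2 *: _]scalerDr !scalerA (_ : _ * (_ ^+ 3)^-1 = k%:R^-1);
    last by field.
  rewrite (_ : _ ^+ 2 * (2 / _) = 2); last by field.
  over.
(* Telescoping yields one more factor [1 / n.+1], hence the cube. *)
rewrite sum_ratio_altV scalerA -invfM -exprSr.
rewrite invfM -scalerA expX_ratio scalerDr rmorphD /= alg_polyC; ring.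
Qed.

Theorem theorem5p2 (n : nat) (hn : (1 <= n)%N) :
  [/\ 'C(2 * n, n)%:R *:
        (\sum_(1 <= k < n.+1) (k%:R * 'C(2 * k, k)%:R)^-1 *: 'X^(k - 1))
      = \sum_(1 <= k < n.+1)
          ('C(2 * n, n - k)%:R / k%:R) *: at_t_sub2 (lucasU k)
        :> {poly rat},
      'C(2 * n, n)%:R *:
        (\sum_(1 <= k < n.+1) (k%:R ^+ 2 * 'C(2 * k, k)%:R)^-1 *: 'X^k)
      = \sum_(1 <= k < n.+1)
          ('C(2 * n, n - k)%:R / k%:R ^+ 2) *: at_t_sub2 (lucasV k)
        + ('C(2 * n, n)%:R * \sum_(1 <= k < n.+1) (k%:R ^+ 2)^-1)%:P
        :> {poly rat}
    & 'C(2 * n, n)%:R *: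
        (\sum_(1 <= k < n.+1) (k%:R ^+ 3 * 'C(2 * k, k)%:R)^-1 *: 'X^k)
      = \sum_(1 <= k < n.+1)
          ('C(2 * n, n - k)%:R / k%:R ^+ 3) *: at_t_sub2 (lucasV k)
        + 2 *: (\sum_(1 <= k < n.+1) \sum_(1 <= j < k)
            ('C(2 * n, n - k)%:R * (-1) ^+ (k - j) / (j%:R * k%:R ^+ 2))
              *: at_t_sub2 (lucasV j))
        + ('C(2 * n, n)%:R * \sum_(1 <= k < n.+1) (k%:R ^+ 3)^-1)%:P
        :> {poly rat}].
Proof.
(* Symmetry of the binomials passes from [n - k] to [n + k]; it needs [k <= n] because of truncated
   subtraction. *)
have binE k : (k <= n)%N -> 'C(2 * n, n - k)%:R = 'C(2 * n, n)%:R * rbin n k.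
  move=> lekn; rewrite addn0 mulrC divfK -?centralE ?central_neq0 //.
  by rewrite -[in RHS]bin_sub; [congr ('C(_, _)%:R) | ]; lia.
split.
- under eq_bigr do rewrite -centralE.
  rewrite sum_shiftU scaler_sumr; apply: eq_big_nat => k /andP[_ lekn].
  by rewrite binE // !scalerA.
- under eq_bigr do rewrite -centralE.
  rewrite sum_shiftV2 scalerDr scaler_sumr polyCM mul_polyC.
  congr (_ + _); apply: eq_big_nat => k /andP[_ lekn].
  by rewrite binE // !scalerA.
under eq_bigr do rewrite -centralE.
rewrite sum_shiftV3 scalerDr scaler_sumr polyCM mul_polyC.
congr (_ + _); rewrite scaler_sumr -big_split /=.
apply: eq_big_nat => k /andP[_ lekn].
rewrite binE // scalerA scalerDr !scalerA; congr (_ + _).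
rewrite /altV !scaler_sumr; apply: eq_bigr => j _.
rewrite !scalerA; congr (_ *: _); rewrite !invfM; ring.
Qed.
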